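(* Let $G$ be a finite group and let $N\trianglelefteq G$. Suppose $(\mathcal X,\mathcal K)$ is a $G$-invariant supercharacter theory of $N$ and $(\mathcal Y,\mathcal L)$ is a supercharacter theory of $G/N$. Then $$\left(\mathcal Y\cup(\mathcal X^\circ)^G,\ \ \mathcal K\cup\widetilde{\mathcal L^\circ}\right)$$ is a supercharacter theory of $G$.
   Context: $\mathrm{Irr}(G)$ is the set of complex irreducible characters of $G$. A supercharacter theory of $G$ is a pair $(\mathcal X,\mathcal K)$, with $\mathcal X$ a partition of $\mathrm{Irr}(G)$ and $\mathcal K$ a partition of $G$, such that $|\mathcal X|=|\mathcal K|$ and for every $X\in\mathcal X$ there is a character $\chi_X$ of $G$ whose irreducible constituents lie in $X$, with each $\chi_X$ constant on every part $K\in\mathcal K$, and every irreducible character of $G$ a constituent of some $\chi_X$. (It is known, by Diaconis and Isaacs, that $\chi_X$ is then a constant multiple of $\sigma_X=\sum_{\psi\in X}\psi(1)\psi$, one always takes $\chi_X=\sigma_X$, and $\{1\}\in\mathcal K$, $\{1_G\}\in\mathcal X$.) A supercharacter theory $(\mathcal X,\mathcal K)$ of $N$ is $G$-invariant if conjugation by $G$ fixes each part $K\in\mathcal K$ setwise; equivalently, every $X\in\mathcal X$ is a union of $G$-orbits on $\mathrm{Irr}(N)$. Notation: $\mathrm{Irr}(G/N)$ is identified with $\{\chi\in\mathrm{Irr}(G): N\subseteq\ker\chi\}$. For $\psi\in\mathrm{Irr}(N)$, $\mathrm{Irr}(G|\psi)$ is the set of $\chi\in\mathrm{Irr}(G)$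 having $\psi$ as a constituent of the restriction $\chi_N$. For a union $Z\subseteq\mathrm{Irr}(N)$ of $G$-orbits, $Z^G=\bigcup_{\psi\in Z}\mathrm{Irr}(G|\psi)$; for a set $\mathcal Z$ of such subsets, $\mathcal Z^G=\{Z^G: Z\in\mathcal Z\}$. $\mathcal X^\circ=\mathcal X\setminus\{\{1_N\}\}$. For $L\subseteq G/N$, $\widetilde L=\bigcup_{Ng\in L}Ng\subseteq G$ is its full preimage; for a set $\mathcal S$ of subsets of $G/N$, $\widetilde{\mathcal S}=\{\widetilde L: L\in\mathcal S\}$. $\mathcal L^\circ=\mathcal L\setminus\{\{N\}\}$, i.e. $\mathcal L$ with the singleton containing the identity coset removed. *)

(* Defs.v *)
From HB Require Import structures.
From mathcomp Require Import all_boot all_order all_algebra.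
From mathcomp Require Import all_fingroup all_solvable all_field all_character.
Set Implicit Arguments.
Unset Strict Implicit.
Unset Printing Implicit Defensive.
Import GroupScope GRing.Theory.
Local Open Scope group_scope.

(* Irr(G) is represented throughout by its index type Iirr G, so a set of
   irreducible characters is a {set Iirr G}, and 0 : Iirr G is the index of the
   principal character. *)

Definition supercharacter_theory (gT : finGroupType) (G : {group gT})
    (X : {set {set Iirr G}}) (K : {set {set gT}}) : Prop :=
  [/\ partition X [set: Iirr G],
      partition K G,
      #|X| = #|K|
    & exists chi : {set Iirr G} -> 'CF(G),
      [/\ forall A, A \in X -> chi A \is a character,
          forall A, A \in X -> {subset irr_constt (chi A) <= A},
          forall A B, A \in X -> B \in K ->
            {in B &, forall x y, chi A x = chi A y}
        & forall i : Iirr G, exists2 A, A \in X & i \in irr_constt (chi A)]].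

Definition conj_invariant (gT : finGroupType) (G : {group gT})
    (K : {set {set gT}}) : Prop :=
  {in K, forall B : {set gT}, {in G, forall g, B :^ g = B}}.

Section Extension.

Variables (gT : finGroupType) (G N : {group gT}).

Definition Irr_over (psi : Iirr N) : {set Iirr G} :=
  [set i | psi \in irr_constt ('Res[N] 'chi[G]_i)%R].

Definition Irr_up (Z : {set Iirr N}) : {set Iirr G} :=
  \bigcup_(psi in Z) Irr_over psi.

Definition Irr_up_family (Z : {set {set Iirr N}}) : {set {set Iirr G}} :=
  [set Irr_up A | A in Z].

(* mod_Iirr is the identification of Irr(G / N) with the irreducible characters
   of G whose kernel contains N; it is only meaningful when N <| G. *)
Definition Irr_inflate_family (Y : {set {set Iirr (G / N)}}) :
    {set {set Iirr G}} :=
  [set [set mod_Iirr i | i in A] | A : {set Iirr (G / N)} in Y].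

Definition drop_principal (X : {set {set Iirr N}}) : {set {set Iirr N}} :=
  X :\ [set 0%R].

Definition preim_family (S : {set {set coset_of N}}) : {set {set gT}} :=
  [set coset N @*^-1 L | L : {set coset_of N} in S].

Definition drop_identity (S : {set {set coset_of N}}) :
    {set {set coset_of N}} :=
  S :\ [set 1].

End Extension.

(* Main.v *)
(* Since |X| = |K|, the characters chi_A (A in X), which are linearly
   independent, span the functions that are constant on the parts of K.
   Expanding the trivial character in them forces {1_G} to be a part of X, and
   an element in the part of 1 lies in every character kernel, so {1} is a part
   of K.

   The supercharacters of the extension are the inflations of those of G / N
   and the induced characters chi_A^G. By G-invariance chi_A^G restricts to
   |G : N| chi_A on N, and it vanishes off N. *)

Require Import Defs.
From HB Require Import structures.
From mathcomp Require Import all_boot all_order all_algebra.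
From mathcomp Require Import all_fingroup all_solvable all_field all_character.
Set Implicit Arguments.
Unset Strict Implicit.
Unset Printing Implicit Defensive.
Import GroupScope GRing.Theory.
Local Open Scope group_scope.

(** * Set partitions: disjoint unions and removal of one part *)

Lemma partition_setU (T : finType) (P Q : {set {set T}}) (A B : {set T}) :
    partition P A -> partition Q B -> [disjoint A & B] ->
  partition (P :|: Q) (A :|: B) /\ #|P :|: Q| = (#|P| + #|Q|)%N.
Proof.
move=> /and3P[/eqP covP triP nP0] /and3P[/eqP covQ triQ nQ0] dAB; split.
  apply/and3P; split; last by rewrite inE negb_or nP0.
    by rewrite /cover bigcup_setU -!/(cover _) covP covQ.
  by apply: trivIsetU; rewrite ?covP ?covQ.
(* The cardinalities add because a common part would be a nonempty subset of both [A] and [B]. *)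
rewrite -cardsUI [P :&: Q]disjoint_setI0 ?cards0 ?addn0 //.
apply/pred0P=> C /=; apply/negP=> /andP[PC QC].
have [x xC] : exists x, x \in C.
  by apply/set0Pn; apply: contraNneq nP0 => <-.
have xA : x \in A by rewrite -covP; apply/bigcupP; exists C.
have xB : x \in B by rewrite -covQ; apply/bigcupP; exists C.
by move/pred0P/(_ x): dAB; rewrite /= xA xB.
Qed.

Lemma partition_setD1 (T : finType) (P : {set {set T}}) (A B : {set T}) :
  partition P A -> B \in P -> partition (P :\ B) (A :\: B).
Proof.
move=> /and3P[/eqP covP triP nP0] PB; apply/and3P; split; last 1 first.
- by rewrite inE negb_and nP0 orbT.
- rewrite eqEsubset; apply/andP; split; apply/subsetP=> x.
    case/bigcupP=> C /setD1P[neCB PC] xC; rewrite inE -covP.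
    apply/andP; split; last by apply/bigcupP; exists C.
    apply: contra neCB => xB.
    by rewrite -(def_pblock triP PC xC) (def_pblock triP PB xB).
  rewrite inE -covP => /andP[nxB /bigcupP[C PC xC]]; apply/bigcupP.
  by exists C => //; rewrite !inE PC andbT; apply: contraNneq nxB => <-.
by apply: trivIsetS triP; apply: subsetDl.
Qed.

(** * Consequences of the axioms for a single supercharacter theory *)

Section Theory.

Variables (gT : finGroupType) (G : {group gT}).
Variables (X : {set {set Iirr G}}) (K : {set {set gT}}).
Hypothesis XK : supercharacter_theory X K.

(** The definition only confines the constituents of [chi A] to [A]. Equality follows because any
    [i] in [A] is a constituent of some [chi B], hence lies in [B], and the parts are disjoint. *)
Lemma supercharacter_exists : exists chi : {set Iirr G} -> 'CF(G),
  [/\ forall A, A \in X -> chi A \is a character,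
      forall A, A \in X -> irr_constt (chi A) =i A
    & forall A B, A \in X -> B \in K ->
        {in B &, forall x y, chi A x = chi A y}].
Proof.
case: XK => /and3P[_ triX _] _ _ [chi [charX subX constX surX]].
exists chi; split=> // A XA i; apply/idP/idP; first exact: subX.
move=> Ai; have [B XB chiBi] := surX i.
by rewrite -(def_pblock triX XA Ai) (def_pblock triX XB (subX _ XB _ chiBi)).
Qed.

(** The table of values of the [chi A] on the parts of [K] is square since [#|X| = #|K|], and its
    rows are independent since distinct [chi A] share no constituent. Its rows therefore span all
    row vectors, in particular the values of [f]. *)
Lemma superclass_const_span (f : 'CF(G)) (chi : {set Iirr G} -> 'CF(G)) :
    (forall A, A \in X -> irr_constt (chi A) =i A) ->
    (forall A B, A \in X -> B \in K ->
       {in B &, forall x y, chi A x = chi A y}) ->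
    (forall B, B \in K -> {in B &, forall x y, f x = f y}) ->
  exists u : {set Iirr G} -> algC, f = (\sum_(A in X) u A *: chi A)%R.
Proof.
case: XK => partX partK cardXK _ consttX constX constf.
have [/and3P[_ triX nX0] /and3P[/eqP covK triK nK0]] := (partX, partK).
pose M := (\matrix_(a < #|X|, b < #|K|)
            chi (enum_val a) (repr (enum_val b)))%R.
have mulM (v : 'rV_#|X|) (b : 'I_#|K|) x : x \in enum_val b ->
    ((v *m M) 0 b = (\sum_a v 0 a *: chi (enum_val a)) x)%R.
  move=> xb; rewrite mxE sum_cfunE; apply: eq_bigr => a _.
  rewrite !mxE cfunE; congr (_ * _)%R.
  by apply: (constX _ (enum_val b)); rewrite ?enum_valP ?(mem_repr x) ?enum_valP.
have rankM : \rank M = #|X|.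
  apply/eqP; rewrite -[_ == _]/(row_free M); apply: inj_row_free => v vM0.
  have chi0 : (\sum_a v 0 a *: chi (enum_val a) = 0)%R.
    apply/cfun_inP=> x; rewrite -{1}covK cfunE => /bigcupP[B KB xB].
    by rewrite -(mulM v (enum_rank_in KB B)) ?vM0 ?mxE ?enum_rankK_in.
  apply/rowP=> a; rewrite mxE.
  (* Pairing the vanishing combination with one irreducible taken from part [a] kills every other
     term and isolates the coefficient [v 0 a]. *)
  have Xa := enum_valP a.
  have [i ai] : exists i, i \in enum_val a.
    by apply/set0Pn; apply: contraNneq nX0 => <-.
  have chiai : i \in irr_constt (chi (enum_val a)) by rewrite consttX.
  have := congr1 (fun phi => '[phi, 'chi_i]%R) chi0; rewrite cfdot0l.
  rewrite cfdot_suml (bigD1 a) //= big1 ?addr0 => [/eqP|c neca].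
    by rewrite cfdotZl mulf_eq0 (negPf chiai) orbF => /eqP.
  rewrite cfdotZl; apply/eqP; rewrite mulf_eq0; apply/orP; right.
  have Xc := enum_valP c; apply: contraR neca.
  rewrite -irr_consttE consttX // => ci; apply/eqP/enum_val_inj.
  by rewrite -(def_pblock triX Xa ai) (def_pblock triX Xc ci).
have fullM : row_full M by rewrite /row_full rankM cardXK.
have /submxP[v def_f] :
    ((\row_b f (repr (enum_val b)) : 'rV_#|K|)%R <= M)%MS by apply: submx_full.
(* [enum_rank_in] needs a member of [X] as base point; [X] is nonempty because it must cover the
   index 0. *)
have [X0|[A0 XA0]] := set_0Vmem X.
  have := cover_partition partX; rewrite X0 /cover big_set0.
  by move/setP/(_ 0%R); rewrite !inE.
exists (fun A => v 0%R (enum_rank_in XA0 A)).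
apply/cfun_inP=> x; rewrite -{1}covK => /bigcupP[B KB xB].
have /(congr1 (fun w : 'rV_#|K| => w 0%R (enum_rank_in KB B))) := def_f.
rewrite mxE (mulM v _ x) enum_rankK_in // => def_fx.
rewrite (constf B KB x (repr B)) ?(mem_repr x) // def_fx; congr (fun_of_cfun _ x).
by rewrite [RHS]big_enum_val; apply: eq_bigr => a _; rewrite enum_valK_in.
Qed.

Lemma principal_part : [set 0%R] \in X.
Proof.
have [chi [charX consttX constX]] := supercharacter_exists.
case: XK => /and3P[/eqP covX triX _] /and3P[/eqP covK _ _] _ _.
have const1 B : B \in K ->
    {in B &, forall x y, (1 : 'CF(G))%R x = (1 : 'CF(G))%R y}.
  move=> KB x y xB yB.
  have sBG : B \subset G by rewrite -covK; apply: bigcup_sup.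
  by rewrite !cfun1E !(subsetP sBG).
have [u def1] := superclass_const_span consttX constX const1.
have /bigcupP[A XA A0] : (0%R : Iirr G) \in cover X by rewrite covX inE.
suffices -> : [set 0%R] = A by [].
apply/setP=> i; rewrite inE; apply/eqP/idP=> [-> //|Ai].
(* Only [chi A] has constituents in [A], so the single scalar [u A] governs all multiplicities
   there. It is nonzero because of [j = 0], so every member of [A] is a constituent of the trivial
   character. *)
have coef j : j \in A -> ('[1, 'chi[G]_j] = u A * '[chi A, 'chi_j])%R.
  move=> Aj; rewrite def1 cfdot_suml (bigD1 A) //= big1 ?addr0 ?cfdotZl //.
  move=> B /andP[XB neBA]; rewrite cfdotZl; apply/eqP; rewrite mulf_eq0.
  apply/orP; right; apply: contraR neBA; rewrite -irr_consttE consttX // => Bj.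
  by rewrite -(def_pblock triX XA Aj) (def_pblock triX XB Bj).
have uA0 : (u A != 0)%R.
  have := coef _ A0; rewrite irr0 cfnorm1 => /eqP; apply: contraTneq => ->.
  by rewrite mul0r oner_eq0.
have := coef _ Ai; rewrite -irr0 cfdot_irr; case: eqP => // _ /esym/eqP.
rewrite mulf_eq0 (negPf uA0) -[_ == _]negbK -irr_consttE.
by rewrite consttX ?Ai.
Qed.

Lemma identity_part : [set 1] \in K.
Proof.
have [chi [charX consttX constX]] := supercharacter_exists.
case: XK => /and3P[/eqP covX _ _] /and3P[/eqP covK _ _] _ _.
have /bigcupP[B KB B1] : 1 \in cover K by rewrite covK.
suffices -> : [set 1] = B by [].
apply/setP=> x; rewrite inE; apply/eqP/idP=> [-> //|Bx].
have Gx : x \in G by rewrite -covK; apply/bigcupP; exists B.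
(* The kernels of the irreducible characters meet trivially, and sharing a part with 1 gives
   [chi A x = chi A 1] for every [A]. *)
suffices: x \in \bigcap_i cfker ('chi[G]_i)%R by rewrite TI_cfker_irr => /set1P.
apply/bigcapP=> i _.
have /bigcupP[A XA Ai] : i \in cover X by rewrite covX inE.
have chiAi : i \in irr_constt (chi A) by rewrite consttX.
apply: (subsetP (cfker_constt (charX A XA) chiAi)).
by rewrite cfkerEchar ?charX // inE Gx (constX A B XA KB x 1) ?eqxx.
Qed.

End Theory.

Lemma supercharacter_theory_intro (gT : finGroupType) (G : {group gT})
    (X : {set {set Iirr G}}) (K : {set {set gT}}) :
    partition X [set: Iirr G] -> partition K G -> #|X| = #|K| ->
    (forall A, A \in X -> exists chi : 'CF(G),
       [/\ chi \is a character, irr_constt chi =i A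
         & forall B, B \in K -> {in B &, forall x y, chi x = chi y}]) ->
  supercharacter_theory X K.
Proof.
move=> partX partK cardXK exchi; split=> //.
have /fin_all_exists[chi chiP] (A : {set Iirr G}) : exists chi : 'CF(G),
    A \in X -> [/\ chi \is a character, irr_constt chi =i A
         & forall B, B \in K -> {in B &, forall x y, chi x = chi y}].
  case: (boolP (A \in X)) => [/exchi[c cP] | _]; first by exists c.
  (* Finite choice asks for a value at every set of indices; off [X] the zero function is an
     arbitrary default. *)
  by exists 0%R.
exists chi; split=> [A /chiP[]// | A /chiP[_ cA _] i | A B /chiP[_ _] | i].
- by rewrite cA.
- exact.
have : i \in cover X by rewrite (cover_partition partX) inE.
by case/bigcupP=> A XA iA; exists A => //; have [_ -> _] := chiP A XA.
Qed.

(** * Induction from [N], inflation from [G / N], and preimages of cosets *)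

Section Extension.

Variables (gT : finGroupType) (G N : {group gT}).
Hypothesis nNG : N <| G.

(** Frobenius reciprocity turns the multiplicity into the product of [theta] with a restriction.
    Multiplicities are nonnegative, so two characters are orthogonal only if they share no
    constituent. *)
Lemma irr_constt_Ind_over (A : {set Iirr N}) (theta : 'CF(N)) :
    theta \is a character -> irr_constt theta =i A ->
  irr_constt ('Ind[G] theta)%R =i Irr_up G A.
Proof.
move=> charth constth i; rewrite irr_consttE -cfdot_Res_r.
have charRes : ('Res[N] 'chi[G]_i)%R \is a character.
  by rewrite cfRes_char ?irr_char.
apply/idP/bigcupP=> [dot_neq0|[psi Apsi]].
  have [psi /andP[Apsi Rpsi] | noA] :=
    pickP [pred psi in A | psi \in irr_constt ('Res[N] 'chi[G]_i)%R].
    by exists psi; rewrite ?inE.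
  case/eqP: dot_neq0; rewrite cfdot_sum_irr big1 // => psi _.
  move/negbT: (noA psi); rewrite /= -constth !irr_consttE negb_and.
  by case/orP=> /negPn/eqP->; rewrite ?mul0r // rmorph0 mulr0.
move: Apsi; rewrite inE -constth => th_psi Res_psi; apply/eqP=> dot0.
have := constt_ortho_char charth charRes th_psi Res_psi dot0.
by apply/eqP; rewrite cfnorm_irr oner_eq0.
Qed.

(** Inflation is an isometry, and every constituent of an inflated character has [N] in its kernel,
    so it is itself inflated. *)
Lemma irr_constt_Mod (A : {set Iirr (G / N)}) (theta : 'CF(G / N)) :
    theta \is a character -> irr_constt theta =i A ->
  irr_constt (theta %% N)%CF =i [set mod_Iirr i | i in A].
Proof.
move=> charth constth.
have constt_mod i : (mod_Iirr i \in irr_constt (theta %% N)%CF) = (i \in A).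
  by rewrite irr_consttE mod_IirrE // cfMod_iso // -irr_consttE constth.
move=> j; apply/idP/imsetP=> [th_j | [i Ai ->]]; last by rewrite constt_mod.
have kerj : N \subset cfker ('chi_j)%R.
  apply: subset_trans (cfker_mod theta nNG) _.
  by apply: cfker_constt; rewrite ?cfMod_char.
by exists (quo_Iirr N j); rewrite -?constt_mod quo_IirrK.
Qed.

Lemma cfInd_invariant (theta : 'CF(N)) (x : gT) :
    x \in N -> {in G, forall g, theta (x ^ g) = theta x} ->
  ('Ind[G] theta x = #|G : N|%:R * theta x)%R.
Proof.
move=> Nx invth; rewrite cfIndE ?normal_sub //.
(* All [#|G|] terms of the induction formula equal [theta x], and dividing by [#|N|] leaves the
   index. *)
rewrite (eq_bigr (fun=> theta x)) // sumr_const -(mulr_natl (theta x)) mulrA.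
congr (_ * _)%R; rewrite -(Lagrange (normal_sub nNG)) natrM mulrA mulVf ?mul1r //.
by rewrite neq0CG.
Qed.

Lemma preim_family_partition (S : {set {set coset_of N}}) (D : {set coset_of N}) :
    D \subset G / N -> partition S D ->
  partition (preim_family S) (coset N @*^-1 D)
  /\ #|preim_family S| = #|S|.
Proof.
move=> sDG /and3P[/eqP covS triS nS0].
have imK L : coset N @* (coset N @*^-1 L) = L by apply: cosetpreK.
(* Disjoint nonempty images give both a partition of their union and injectivity of the indexing,
   which supplies the cardinality. *)
have [||partS injS] := @indexed_partition _ _ (mem S) (fun L => coset N @*^-1 L).
- move=> L1 L2 SL1 SL2 ne21; rewrite -setI_eq0 -morphpreI.
  have /trivIsetP/(_ L1 L2 SL1 SL2) := triS; rewrite eq_sym => /(_ ne21).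
  by rewrite -setI_eq0 => /eqP->; rewrite morphpre0.
- move=> L SL; apply: contraNneq nS0 => L0.
  by rewrite -(morphim0 (coset_morphism N)) -L0 imK.
split; last exact: card_in_imset.
rewrite /preim_family.
suffices <- : cover [set coset N @*^-1 L | L in S] = coset N @*^-1 D by [].
rewrite cover_imset -covS; apply/setP=> x; apply/bigcupP/morphpreP.
  case=> L SL /morphpreP[Nx Lx]; split=> //.
  by apply/bigcupP; exists L.
case=> Nx /bigcupP[L SL Lx]; exists L => //.
exact/morphpreP.
Qed.

Lemma Irr_inflate_partition (Y : {set {set Iirr (G / N)}}) :
    partition Y [set: Iirr (G / N)] ->
  partition (Irr_inflate_family Y) [set i | N \subset cfker ('chi[G]_i)%R]
  /\ #|Irr_inflate_family Y| = #|Y|.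
Proof.
move=> /and3P[/eqP covY triY nY0].
have injmod := can_inj (mod_IirrK nNG).
have [||partY injY] := @indexed_partition _ _ (mem Y)
  (fun A => [set mod_Iirr i | i in A]).
- move=> A B YA YB neBA; rewrite -setI_eq0 -imsetI; last by move=> i j _ _ /injmod.
  have /trivIsetP/(_ A B YA YB) := triY; rewrite eq_sym => /(_ neBA).
  by rewrite -setI_eq0 => /eqP->; rewrite imset0.
- by move=> A YA; rewrite imset_eq0; apply: contraNneq nY0 => <-.
split; last exact: card_in_imset.
rewrite /Irr_inflate_family.
suffices <- : cover [set [set mod_Iirr i | i in A] | A : {set Iirr (G / N)} in Y]
    = [set i | N \subset cfker ('chi[G]_i)%R] by [].
rewrite cover_imset -imset_cover covY; apply/setP=> j; rewrite inE.
apply/imsetP/idP=> [[i _ ->] | kerj]; first by rewrite mod_IirrE // cfker_mod.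
by exists (quo_Iirr N j); rewrite ?inE ?quo_IirrK.
Qed.

Lemma Irr_over_principal i :
  (i \in Irr_over G (0%R : Iirr N)) = (N \subset cfker ('chi[G]_i)%R).
Proof.
rewrite inE; apply/idP/idP=> [|kerN]; first exact: constt0_Res_cfker.
by rewrite irr_consttE cfRes_sub_ker // irr0 cfdotZl cfnorm1 mulr1 irr1_neq0.
Qed.

(** * Induction from a [G]-invariant supercharacter theory of [N] *)

Section Invariant.

Variables (X : {set {set Iirr N}}) (K : {set {set gT}}).
Hypotheses (XK : supercharacter_theory X K) (invK : conj_invariant G K).

Lemma superclass_const_conj (theta : 'CF(N)) :
    (forall B, B \in K -> {in B &, forall x y, theta x = theta y}) ->
  {in N & G, forall x g, theta (x ^ g) = theta x}.
Proof.
case: XK => _ /cover_partition covK _ _ constth x g; rewrite -{1}covK.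
case/bigcupP=> B KB Bx Gg; apply: (constth B) => //.
by rewrite -(invK KB Gg) memJ_conjg.
Qed.

(* By Frobenius reciprocity <chi_A^G, chi_B^G> = |G : N| <chi_A, chi_B>, so
   chi_A^G and chi_B^G share no constituent; Clifford theory is not needed. *)
Lemma Irr_up_disjoint :
  {in X &, forall A B, A != B -> [disjoint Irr_up G A & Irr_up G B]}.
Proof.
have [chi [charX consttX constX]] := supercharacter_exists XK.
case: XK => /and3P[_ triX _] _ _ _ A B XA XB neAB.
apply/pred0P=> i /=; apply/negP=> /andP[].
rewrite -(irr_constt_Ind_over (charX A XA) (consttX A XA)) => Ai.
rewrite -(irr_constt_Ind_over (charX B XB) (consttX B XB)) => Bi.
have chiInd C : C \in X -> ('Ind[G] (chi C))%R \is a character.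
  by move=> XC; rewrite cfInd_char ?charX.
suffices /(constt_ortho_char (chiInd A XA) (chiInd B XB) Ai Bi)/eqP :
    '['Ind[G] (chi A), 'Ind[G] (chi B)]%R = 0%R.
  by rewrite cfnorm_irr oner_eq0.
(* After reciprocity, invariance of [chi B] identifies the restriction of its induced character with
   [#|G : N|%:R *: chi B]. *)
have -> : ('['Ind[G] (chi A), 'Ind[G] (chi B)]
           = '[chi A, #|G : N|%:R *: chi B])%R.
  rewrite -cfdot_Res_r; congr '[_, _]%R; apply/cfun_inP=> x Nx.
  rewrite cfResE ?normal_sub // cfunE cfInd_invariant // => g Gg.
  by apply: superclass_const_conj => // C KC; apply: constX.
rewrite cfdotZr cfdot_sum_irr big1 ?mulr0 // => i' _.
apply/eqP; apply: contraNT neAB; rewrite mulf_eq0 => /norP[Ai' Bi'].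
have {Bi'} Bi' : ('[chi B, 'chi_i'] != 0)%R.
  by apply: contraNneq Bi' => ->; rewrite rmorph0.
move: Ai' Bi'; rewrite -!irr_consttE !consttX // => Ai' Bi'.
by rewrite -(def_pblock triX XA Ai') (def_pblock triX XB Bi').
Qed.

(** The characters over the principal one are exactly those with [N] in the kernel, so discarding
    that part leaves the complement. Each part is nonempty because every irreducible of [N] lies
    under one of [G]. *)
Lemma Irr_up_partition :
  partition (Irr_up_family G (drop_principal X))
    [set i | ~~ (N \subset cfker ('chi[G]_i)%R)]
  /\ #|Irr_up_family G (drop_principal X)| = #|drop_principal X|.
Proof.
have X0 := principal_part XK.
case: (XK) => partX _ _ _; have /and3P[/eqP covX _ nX0] := partX.
have up0 : Irr_up G [set (0%R : Iirr N)] = [set i | N \subset cfker ('chi[G]_i)%R].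
  by apply/setP=> i; rewrite /Irr_up big_set1 Irr_over_principal inE.
have [||partU injU] := @indexed_partition _ _ (mem (drop_principal X)) (@Irr_up _ G N).
- move=> A B /setD1P[_ XA] /setD1P[_ XB]; rewrite eq_sym; exact: Irr_up_disjoint.
- move=> A /setD1P[_ XA].
  have /set0Pn[psi Apsi] : A != set0 by apply: contraNneq nX0 => <-.
  have [i psii] := constt_cfInd_irr psi (normal_sub nNG).
  apply/set0Pn; exists i; apply/bigcupP; exists psi => //.
  by rewrite inE -constt_Ind_Res.
split; last exact: card_in_imset.
rewrite /Irr_up_family.
suffices <- : cover [set Irr_up G A | A in drop_principal X]
    = [set i | ~~ (N \subset cfker ('chi[G]_i)%R)] by [].
rewrite cover_imset; apply/setP=> i; rewrite inE; apply/bigcupP/idP.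
  case=> A /setD1P[neA0 XA] Ai.
  have /pred0P/(_ i) := Irr_up_disjoint XA X0 neA0.
  by rewrite /= Ai up0 inE /= => ->.
move=> nker; have [psi psii] := constt_cfRes_irr N i.
have /bigcupP[A XA Apsi] : psi \in cover X by rewrite covX inE.
have Ai : i \in Irr_up G A by apply/bigcupP; exists psi; rewrite ?inE.
exists A => //; rewrite !inE XA andbT; apply: contraNneq nker => defA.
by move: Ai; rewrite defA up0 inE.
Qed.

End Invariant.

End Extension.

(** * Assembly of the extended theory *)

Theorem theorem5p2 (gT : finGroupType) (G N : {group gT})
    (X : {set {set Iirr N}}) (K : {set {set gT}})
    (Y : {set {set Iirr (G / N)}}) (L : {set {set coset_of N}})
    (nNG : N <| G)
    (XK : supercharacter_theory X K)
    (invK : conj_invariant G K)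
    (YL : supercharacter_theory (G := (G / N)%G) Y L) :
  supercharacter_theory
    (Irr_inflate_family Y :|: Irr_up_family G (drop_principal X))
    (K :|: preim_family (drop_identity L)).
Proof.
have X0 := principal_part XK; have L1 := identity_part YL.
have [chi [charX consttX constX]] := supercharacter_exists XK.
have [xi [charY consttY constY]] := supercharacter_exists YL.
case: (XK) (YL) => _ partK cardXK _ [partY partL cardYL _].
have sNG := normal_sub nNG.
have sKN B : B \in K -> B \subset N.
  by move=> KB; rewrite -(cover_partition partK); apply: bigcup_sup.
have nN1 M : M \in drop_identity L -> 1 \notin M.
  case/setD1P=> neM1 LM; apply: contra neM1 => M1.
  have /and3P[_ triL _] := partL.
  by rewrite -(def_pblock triL LM M1) (def_pblock triL L1 (set11 1)).
have NcosetM M : M \in drop_identity L -> {in coset N @*^-1 M, forall x, x \notin N}.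
  move=> LM x /morphpreP[_ Mx]; apply: contra (nN1 M LM) => Nx.
  by move: Mx; rewrite /= coset_id.
have [partI cardI] := Irr_inflate_partition nNG partY.
have [partU cardU] := Irr_up_partition nNG XK invK.
have [partP cardP] :=
  preim_family_partition (subsetDl (G / N) [set 1]) (partition_setD1 partL L1).
have [|partIU cardIU] := partition_setU partI partU.
  by apply/pred0P=> i; rewrite /= !inE andbN.
have [|partKP cardKP] := partition_setU partK partP.
  apply/pred0P=> x /=; apply/negP=> /andP[Nx /morphpreP[_]].
  by rewrite !inE /= coset_id ?eqxx.
apply: supercharacter_theory_intro.
- suffices <- : [set i | N \subset cfker ('chi[G]_i)%R]
      :|: [set i | ~~ (N \subset cfker ('chi[G]_i)%R)] = setT by [].
  by apply/setP=> i; rewrite !inE orbN.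
(* The preimage of the nonidentity cosets is [G] minus [N], the kernel of [coset N]. *)
- suffices <- : N :|: coset N @*^-1 (G / N :\ 1) = G by [].
  rewrite morphpreD quotientGK // -[coset N @*^-1 [set 1]]/('ker (coset N)) ker_coset.
  apply/setP=> x; rewrite !inE.
  by case: (boolP (x \in N)) => //= Nx; rewrite (subsetP sNG).
(* One part is dropped from [X] and one from [L], so the two totals still agree. *)
- rewrite cardIU cardKP cardI cardU cardP cardYL -cardXK.
  by rewrite (cardsD1 [set 0%R] X) X0 (cardsD1 [set 1] L) L1 addnAC.
move=> A /setUP[/imsetP[C YC ->] | /imsetP[C /setD1P[_ XC] ->]].
  exists (xi C %% N)%CF; split.
  - by rewrite cfMod_char ?charY.
  - by apply: irr_constt_Mod; [| apply: charY | apply: consttY].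
  move=> B /setUP[KB x y Bx By | /imsetP[M /setD1P[_ LM] ->] x y].
    (* On [N] an inflated character takes only its value at 1. *)
    have [Nx Ny] := (subsetP (sKN B KB) x Bx, subsetP (sKN B KB) y By).
    by rewrite !cfModE ?(subsetP sNG) // !coset_id.
  have sMG : M \subset G / N.
    by rewrite -(cover_partition partL); apply: bigcup_sup.
  move=> Mx My.
  have inG z : z \in coset N @*^-1 M -> z \in G.
    move=> Mz; rewrite -(quotientGK nNG).
    exact: subsetP (morphpreS _ sMG) z Mz.
  rewrite !cfModE ?inG //.
  case/morphpreP: Mx => _ Mx; case/morphpreP: My => _ My.
  exact: (constY C M).
exists ('Ind[G] (chi C))%R; split.
- by rewrite cfInd_char ?charX.
- by apply: irr_constt_Ind_over; [apply: charX | apply: consttX].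
move=> B /setUP[KB x y Bx By | /imsetP[M LM ->] x y Mx My].
  (* Inside [N] the induced character is a multiple of [chi C], which is constant on [B]. *)
  have constC : forall B, B \in K -> {in B &, forall x y, chi C x = chi C y}.
    by move=> ?; apply: constX.
  have [Nx Ny] := (subsetP (sKN B KB) x Bx, subsetP (sKN B KB) y By).
  have inv := superclass_const_conj XK invK constC.
  rewrite !cfInd_invariant //; first by congr (_ * _)%R; apply: (constX C B).
  - by move=> g Gg; apply: inv.
  - by move=> g Gg; apply: inv.
(* The remaining parts avoid [N], where an induced character is supported by normality. *)
have Ind0 z : z \in coset N @*^-1 M -> ('Ind[G] (chi C) z = 0)%R.
  by move=> Mz; rewrite (cfun_on0 (cfInd_normal _ nNG)) ?(NcosetM M).
by rewrite !Ind0.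
Qed.
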